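(* Let $K$ be an inversive difference field of functions $f(x,t)$ with basic set $\sigma=\{\alpha_1,\alpha_2\}$, $\alpha_1:f(x,t)\mapsto f(x+h,t)$, $\alpha_2:f(x,t)\mapsto f(x,t+h)$, and let $K\{y\}^{\ast}$ be the ring of $\sigma^{\ast}$-polynomials in one $\sigma^{\ast}$-indeterminate $y$ over $K$. Let $a\in K$ be a nonzero constant. Then the $\sigma^{\ast}$-polynomial $$B=a\alpha_1y+a\alpha_1^{-1}y-\alpha_2y+\alpha_2^{-1}y-2ay$$ (the left-hand side of the symmetric difference scheme for the diffusion equation $\partial u/\partial t=c\,\partial^2u/\partial x^2$, with $a=2c/h$) generates a prime $\sigma^{\ast}$-ideal $[B]^{\ast}$ of $K\{y\}^{\ast}$, and the $\sigma^{\ast}$-dimension polynomial of $[B]^{\ast}$ (the Einstein's strength of the scheme) is $$\psi_{Symm}(t)=4t.$$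
   Context: All fields have characteristic zero. An inversive difference ($\sigma^{\ast}$-) field $K$ with basic set $\sigma=\{\alpha_1,\alpha_2\}$ is a field with commuting automorphisms $\alpha_1,\alpha_2$; an element $a$ is a constant if $\alpha_1(a)=\alpha_2(a)=a$. $\Gamma$ is the free commutative group generated by $\sigma$. $K\{y\}^{\ast}$ is the polynomial ring over $K$ in the algebraically independent indeterminates $\gamma y$ ($\gamma\in\Gamma$, $1\cdot y=y$), on which $\Gamma$ acts by extending its action on $K$ with $\beta(\gamma y)=(\beta\gamma)y$. $[B]^{\ast}$ is the ideal generated by $\{\gamma B\mid\gamma\in\Gamma\}$. For $\gamma=\alpha_1^{k_1}\alpha_2^{k_2}$, $\mathrm{ord}\,\gamma=|k_1|+|k_2|$, and $\Gamma(r)=\{\gamma\in\Gamma\mid\mathrm{ord}\,\gamma\le r\}$. The $\sigma^{\ast}$-dimension polynomial of a prime $\sigma^{\ast}$-ideal $P$ of $K\{y\}^{\ast}$ is the unique polynomial $\psi(t)\in\mathbb{Q}[t]$ such that $\psi(r)=\mathrm{tr.deg}_KK(\{\gamma\eta\mid\gamma\in\Gamma(r)\})$ for all sufficiently large $r\in\mathbb{N}$, where $\eta$ is the canonical image of $y$ in the quotient field of $K\{y\}^{\ast}/P$. *)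

(* Defs.v *)
From HB Require Import structures.
From mathcomp Require Import all_boot all_order all_algebra.
From mathcomp Require Import ring_quotient generic_quotient fraction.
From mathcomp Require Import finmap monalg.
From mathcomp Require Import boolp.

Set Implicit Arguments.
Unset Strict Implicit.
Unset Printing Implicit Defensive.

Import GRing.Theory.

Local Open Scope ring_scope.
Local Open Scope quotient_scope.

(* [{ideal_quot P}] only comes with a ring structure; the instances below make
   it an integral domain (units are decided classically), so that its field of
   fractions can be formed when [P] is prime. *)
Section ResidueDomain.
Variables (R : comNzRingType) (P : prime_idealr R).

Definition residue : Type := {ideal_quot P}.

HB.instance Definition _ := GRing.ComNzRing.on residue.

Definition residue_unit : pred residue := fun x => `[< exists y, y * x = 1 >].

Definition residue_inv (x : residue) : residue :=
  match pselect (exists y, y * x = 1) with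
  | left ex => projT1 (cid ex)
  | right _ => x
  end.

Fact residue_mulVx : {in residue_unit, left_inverse 1 residue_inv *%R}.
Proof.
move=> x /asboolP ex; rewrite /residue_inv.
by case: pselect => // ex'; case: (cid ex').
Qed.

Fact residue_unitP (x y : residue) : y * x = 1 -> residue_unit x.
Proof. by move=> yx1; apply/asboolP; exists y. Qed.

Fact residue_inv_out : {in [predC residue_unit], residue_inv =1 id}.
Proof.
move=> x; rewrite inE /= => /negP ux; rewrite /residue_inv.
by case: pselect => // ex; case: ux; apply/asboolP.
Qed.

HB.instance Definition _ := GRing.ComNzRing_hasMulInverse.Build residue
  residue_mulVx residue_unitP residue_inv_out.

HB.instance Definition _ := GRing.ComUnitRing_isIntegral.Build residue
  (@Quotient.rquot_IdomainAxiom R P).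

Definition residue_field : fieldType := {fraction residue}.

Definition to_residue_field (p : R) : residue_field :=
  FracField.tofrac (\pi_({ideal_quot P}) p : residue).

End ResidueDomain.

(* [{malg K[{cmonom I}]}] is the polynomial ring over [K] in the independent
   indeterminates [indet i], [i : I], where [I] may be infinite. *)
Definition indet (K : nzRingType) (I : choiceType) (i : I) :
  {malg K[{cmonom I}]} := << ucm i >>.

(* Apply [f] to the coefficients and substitute [b i] for [indet i]. *)
Definition poly_subst (K : nzRingType) (I : choiceType) (S : comNzRingType)
    (f : K -> S) (b : I -> S) (p : {malg K[{cmonom I}]}) : S :=
  mmap f (fun m : {cmonom I} => \prod_(i <- finsupp m) b i ^+ m i) p.

Section TranscendenceDegree.
Variables (K L : fieldType) (iota : K -> L).

Definition alg_independent (I : choiceType) (b : I -> L) : Prop :=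
  forall p : {malg K[{cmonom I}]}, poly_subst iota b p = 0 -> p = 0.

(* [K(X)], as the intersection of all subfields of [L] containing [K] and [X]. *)
Definition adjoin (X : L -> Prop) (z : L) : Prop :=
  forall F : divringClosed L,
    (forall c, iota c \in F) -> (forall x, X x -> x \in F) -> z \in F.

Definition algebraic_over (F : L -> Prop) (z : L) : Prop :=
  exists q : {poly L}, [/\ q != 0, forall i, F q`_i & root q z].

(* [tr.deg_K F = n], for an intermediate field [F] of [L/K]. *)
Definition trdeg_eq (F : L -> Prop) (n : nat) : Prop :=
  exists b : 'I_n -> L,
    [/\ forall i, F (b i), alg_independent b
      & forall z, F z -> algebraic_over (adjoin (fun x => exists i, x = b i)) z].

End TranscendenceDegree.

Record automorphism (K : fieldType) := Automorphism {
  aut_fun :> {rmorphism K -> K};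
  aut_inv : K -> K;
  aut_funK : cancel aut_fun aut_inv;
  aut_invK : cancel aut_inv aut_fun
}.

Definition aut_pow (K : fieldType) (s : automorphism K) (k : int) : K -> K :=
  match k with
  | Posz n => iter n s
  | Negz n => iter n.+1 (aut_inv s)
  end.

(* The free commutative group on [alpha1], [alpha2], written additively:
   [(k1, k2)] stands for [alpha1 ^ k1 * alpha2 ^ k2]. *)
Notation Gam := (int * int)%type.

Definition gord (g : Gam) : nat := (`|g.1|%N + `|g.2|%N)%N.

(* [K{y}^*]; the indeterminate [indet K g] is the one usually written [g y]. *)
Notation sigma_poly K := {malg K[{cmonom Gam}]}.

Definition gy (K : fieldType) (k1 k2 : int) : sigma_poly K :=
  indet K (k1, k2).

Section SigmaIdeals.
Variables (K : fieldType) (alpha1 alpha2 : automorphism K).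

Definition gact (g : Gam) (c : K) : K :=
  aut_pow alpha1 g.1 (aut_pow alpha2 g.2 c).

Definition gact_poly (g : Gam) (p : sigma_poly K) : sigma_poly K :=
  poly_subst (fun c => (gact g c)%:MP) (fun b : Gam => indet K (g + b)) p.

(* [B]^*, the ideal generated by all [g B]. *)
Definition sigma_ideal (B : sigma_poly K) : {pred sigma_poly K} :=
  fun p => `[< exists s : seq (sigma_poly K * Gam),
                 p = \sum_(u <- s) u.1 * gact_poly u.2 B >].

Definition sigma_stable (I : {pred sigma_poly K}) : Prop :=
  forall g p, p \in I -> gact_poly g p \in I.

(* The action of [g] on the residue field sends the class [eta] of [y] to the
   class of [g y]. *)
Definition sigma_dim_poly (P : prime_idealr (sigma_poly K)) (psi : {poly rat}) : Prop :=
  exists r0 : nat, forall r : nat, (r0 <= r)%N ->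
    exists2 n : nat,
      trdeg_eq (fun c : K => to_residue_field P c%:MP)
        (adjoin (fun c : K => to_residue_field P c%:MP)
          (fun z => exists2 g : Gam, (gord g <= r)%N
                                   & z = to_residue_field P (indet K g))) n
    & psi.[r%:R] = n%:R.

End SigmaIdeals.

(* Main.v *)
Require Import Defs.
From HB Require Import structures.
From mathcomp Require Import all_boot all_order all_algebra.
From mathcomp Require Import ring_quotient generic_quotient fraction.
From mathcomp Require Import finmap monalg.
From mathcomp Require mpoly.
From mathcomp Require Import boolp zify.

Set Implicit Arguments.
Unset Strict Implicit.
Unset Printing Implicit Defensive.

Import GRing.Theory.
Local Open Scope ring_scope.
Local Open Scope quotient_scope.

(* Write [y_(k, l)] for [alpha1 ^ k alpha2 ^ l y]. The relation [g B = 0] for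
   [g = (k, l)] can be solved for [y_(k, l + 1)] and for [y_(k, l - 1)], as their
   coefficients are -1 and 1; hence every [y_g] is a unique linear combination
   [v g] of the indeterminates of rows 0 and 1. The substitution [y_g |-> v g] is
   an endomorphism of [K{y}^*] whose kernel is [B]^*, and polynomial rings are
   integral domains, so [B]^* is prime and the classes of the indeterminates of
   rows 0 and 1 are algebraically independent. Reducing [y_(k, l)] to rows 0 and 1
   does not leave the ball of [Gamma] of radius [|k| + |l|], so the points of these
   two rows in [Gamma(r)] give a transcendence basis; there are [4 r] of them. *)

(** * Substitution as a morphism of polynomial rings in arbitrarily many indeterminates *)

Section MonomialEvaluation.
Variables (I : choiceType) (S : comNzRingType) (b : I -> S).

Definition cmonom_eval (m : {cmonom I}) : S := \prod_(i <- finsupp m) b i ^+ m i.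

Lemma cmonom_evalEw (d : {fset I}) (m : {cmonom I}) : (finsupp m `<=` d)%fset ->
  cmonom_eval m = \prod_(i <- d) b i ^+ m i.
Proof.
move=> le; rewrite /cmonom_eval (big_fset_incl _ le) //= => i _.
by rewrite -cmE_eq0 => /eqP ->; rewrite expr0.
Qed.

Lemma cmonom_eval_mmorphism : mmorphism cmonom_eval.
Proof.
split=> [m1 m2|]; last by rewrite /cmonom_eval mdom1 big_nil.
rewrite (@cmonom_evalEw (finsupp m1 `|` finsupp m2)%fset m1) ?fsubsetUl //.
rewrite (@cmonom_evalEw (finsupp m1 `|` finsupp m2)%fset m2) ?fsubsetUr //.
rewrite {1}/cmonom_eval mdomD -big_split /=.
by apply: eq_bigr => i _; rewrite cmM exprD.
Qed.

HB.instance Definition _ :=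
  isMultiplicative.Build {cmonom I} S cmonom_eval cmonom_eval_mmorphism.

End MonomialEvaluation.

(** [poly_subst f b] unfolds to [mmap] along the monoid morphism [cmonom_eval b], so its ring
    morphism structure can be copied. *)
HB.instance Definition _ (K : nzRingType) (I : choiceType) (S : comNzRingType)
    (f : {rmorphism K -> S}) (b : I -> S) :=
  GRing.RMorphism.copy (poly_subst f b) (mmap f (cmonom_eval b)).

Section PolySubst.
Variables (K : comNzRingType) (I : choiceType).
Local Notation poly := {malg K[{cmonom I}]}.

Lemma poly_substC (S : comNzRingType) (f : {rmorphism K -> S}) (b : I -> S) c :
  poly_subst f b c%:MP = f c.
Proof. exact: (mmapC (h := cmonom_eval b)). Qed.

Lemma poly_subst_indet (S : comNzRingType) (f : {rmorphism K -> S}) (b : I -> S) i :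
  poly_subst f b (indet K i) = b i.
Proof.
rewrite /poly_subst mmapU /= rmorph1 mul1r mdomU big_seq_fset1.
by rewrite cmUU expr1.
Qed.

(** Monomials are reached by induction on their degree, splitting off one indeterminate at a time; a
    polynomial is then a sum of constants times monomials. *)
Lemma malg_indet_ind (P : poly -> Prop) :
    (forall c, P c%:MP) -> (forall i, P (indet K i)) ->
    (forall p q, P p -> P q -> P (p + q)) ->
    (forall p q, P p -> P q -> P (p * q)) ->
  forall p, P p.
Proof.
move=> PC PX PD PM p.
have P0 : P 0 by rewrite -malgC0E; apply: PC.
have Pmon (m : {cmonom I}) : P << m >>.
  have [n] := ubnP (mdeg m); elim: n m => // n IHn m.
  have [->|] := eqVneq m mone; first by move=> _; apply: PC.
  rewrite -mdeg_eq0 => m0 /ltnSE lt_m.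
  have [i mi] : exists i, m i != 0%N.
    apply/not_existsP => H; case/negP: m0.
    apply/eqP; rewrite mdegE big1_seq // => i _.
    by have [//|mi0] := eqVneq (m i) 0%N; case: (H i).
  pose m' : {cmonom I} := divcm m (ucm i).
  have mE : m = mmul (ucm i) m'.
    apply/eqP/cmP => j; rewrite cmM cmU divcmE cmU.
    by case: eqP => [<-|_] /=; lia.
  have -> : << m >> = indet K i * << m' >> :> poly.
    by rewrite mE /indet malgM_def fgmulUU mulr1.
  apply: PM => //; apply: IHn.
  by move: lt_m; rewrite mE mdegM mdegU; lia.
rewrite [p]monalgE; elim/big_ind: _ => // m _.
have -> : << p@_m *g m >> = (p@_m)%:MP * << m >> :> poly.
  by rewrite malgM_def fgmulUU mulr1 mul1m.
exact: PM.
Qed.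

Lemma rmorph_indet_ext (S : nzRingType) (f g : {rmorphism poly -> S}) :
    (forall c, f c%:MP = g c%:MP) -> (forall i, f (indet K i) = g (indet K i)) ->
  f =1 g.
Proof.
move=> fgC fgX; elim/malg_indet_ind=> // p q pE qE.
  by rewrite !rmorphD pE qE.
by rewrite !rmorphM pE qE.
Qed.

End PolySubst.

(** * Polynomial rings over a domain have no zero divisors *)

Section NoZeroDivisors.
Import mpoly.
Variables (K : idomainType) (I : choiceType) (s : {fset I}).
Local Notation n := #|{: s}|.

(** Reading exponents along an enumeration of the finite set [s] leads to [mpoly], which is an
    integral domain. *)
Definition restrict_cmonom (m : {cmonom I}) : multinom n :=
  [multinom m (val (enum_val i)) | i < n].

Definition monom_restr (m : {cmonom I}) : mpoly n K :=
  mpolyX K (restrict_cmonom m).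

Lemma monom_restr_mmorphism : mmorphism monom_restr.
Proof.
split=> [m1 m2|].
  rewrite /monom_restr -mpolyXD; congr mpolyX.
  by apply/mnmP => i; rewrite mnmDE !mnmE cmM.
rewrite /monom_restr -mpolyX0; congr mpolyX.
by apply/mnmP => i; rewrite !mnmE cm1.
Qed.

HB.instance Definition _ :=
  isMultiplicative.Build {cmonom I} (mpoly n K) monom_restr
    monom_restr_mmorphism.

Lemma restrict_cmonom_inj (m1 m2 : {cmonom I}) :
    (finsupp m1 `<=` s)%fset -> (finsupp m2 `<=` s)%fset ->
  restrict_cmonom m1 = restrict_cmonom m2 -> m1 = m2.
Proof.
move=> s1 s2 /mnmP eq12; apply/eqP/cmP => i.
have [si|nsi] := boolP (i \in s).
  by have := eq12 (enum_rank [` si]%fset); rewrite !mnmE enum_rankK.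
have out (m : {cmonom I}) : (finsupp m `<=` s)%fset -> m i = 0%N.
  by move=> /fsubsetP sm; apply/eqP; rewrite cmE_eq0; apply: contra nsi => /sm.
by rewrite !out.
Qed.

Lemma mmap_restr_neq0 (p : {malg K[{cmonom I}]}) :
    (forall m, m \in monalg.msupp p -> (finsupp m `<=` s)%fset) ->
  p != 0 -> monalg.mmap (mpolyC n (R := K)) monom_restr p != 0.
Proof.
move=> sp; rewrite -monalg.msupp_eq0 => /fset0Pn[m0 pm0].
(* Restriction is injective on the monomials of [p], so only [m0] contributes to this coefficient,
   which is therefore that of [p] at [m0]. *)
apply/eqP => /(congr1 (fun q => mcoeff (restrict_cmonom m0) q)).
rewrite mcoeff0 /monalg.mmap raddf_sum /= (big_fsetD1 m0) //= big1_fset => [|m].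
  rewrite mcoeffCM mcoeffX eqxx mulr1 addr0.
  by apply/eqP; rewrite monalg.mcoeff_neq0.
rewrite in_fsetD1 => /andP[m_m0 pm] _; rewrite mcoeffCM mcoeffX.
case: eqP => [/restrict_cmonom_inj mE|]; last by rewrite mulr0.
by case/eqP: m_m0; apply: mE; apply: sp.
Qed.

Lemma mulf_neq0_restr (p q : {malg K[{cmonom I}]}) :
    (forall m, m \in monalg.msupp p -> (finsupp m `<=` s)%fset) ->
    (forall m, m \in monalg.msupp q -> (finsupp m `<=` s)%fset) ->
  p != 0 -> q != 0 -> p * q != 0.
Proof.
move=> sp sq p0 q0; have hp := mmap_restr_neq0 sp p0; have hq := mmap_restr_neq0 sq q0.
have := mulf_neq0 hp hq; rewrite -rmorphM; apply: contra => /eqP ->.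
by rewrite rmorph0.
Qed.

End NoZeroDivisors.

Lemma malg_cmonom_mulf_eq0 (K : idomainType) (I : choiceType)
    (p q : {malg K[{cmonom I}]}) :
  (p * q == 0) = (p == 0) || (q == 0).
Proof.
apply/idP/idP; last by case/orP => /eqP ->; rewrite (mul0r, mulr0).
apply: contraLR; rewrite negb_or => /andP[p0 q0].
(* The finitely many indeterminates that occur in [p] or [q]. *)
pose s := (\bigcup_(m <- msupp p `|` msupp q) finsupp m)%fset.
have sP (m : {cmonom I}) : m \in (msupp p `|` msupp q)%fset -> (finsupp m `<=` s)%fset.
  by move=> ms; apply: bigfcup_sup.
by apply: (@mulf_neq0_restr _ _ s) => // m pm; apply: sP; rewrite in_fsetU pm ?orbT.
Qed.

(** * The map to the residue field of a prime ideal *)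

Section ResidueField.
Variables (R : comNzRingType) (P : prime_idealr R).

Lemma to_residue_field_zmod_morphism : zmod_morphism (to_residue_field P).
Proof.
move=> p q; rewrite /to_residue_field -rmorphB /=; congr FracField.tofrac.
exact: (rmorphB (\pi_({ideal_quot P}))).
Qed.

Lemma to_residue_field_monoid_morphism : monoid_morphism (to_residue_field P).
Proof.
split=> [|p q]; rewrite /to_residue_field.
  by rewrite (rmorph1 (\pi_({ideal_quot P}))) rmorph1.
by rewrite (rmorphM (\pi_({ideal_quot P}))) rmorphM.
Qed.

HB.instance Definition _ := GRing.isZmodMorphism.Build R (residue_field P)
  (to_residue_field P) to_residue_field_zmod_morphism.
HB.instance Definition _ := GRing.isMonoidMorphism.Build R (residue_field P)
  (to_residue_field P) to_residue_field_monoid_morphism.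

Lemma to_residue_field_eq0 p : (to_residue_field P p == 0) = (p \in P).
Proof.
rewrite /to_residue_field tofrac_eq0 -[p in RHS]subr0 Quotient.idealrBE.
by rewrite (rmorph0 (\pi_({ideal_quot P}))).
Qed.

End ResidueField.

(** * The action of [Gam] and the ideals it generates *)

Section Automorphisms.
Variable K : fieldType.

Lemma aut_pow_zmod_morphism (s : automorphism K) k : zmod_morphism (aut_pow s k).
Proof.
have iterB (f : K -> K) n : zmod_morphism f -> zmod_morphism (iter n f).
  by move=> fB x y; elim: n => //= n ->; rewrite fB.
case: k => n; apply: iterB; first exact: rmorphB.
exact: (can2_zmod_morphism (aut_funK s) (aut_invK s)).
Qed.

Lemma aut_pow_monoid_morphism (s : automorphism K) k : monoid_morphism (aut_pow s k).
Proof.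
have iterM (f : K -> K) n : monoid_morphism f -> monoid_morphism (iter n f).
  move=> [f1 fM]; split=> [|x y]; first by elim: n => //= n ->.
  by elim: n => //= n ->; rewrite fM.
case: k => n; apply: iterM; first by split; [exact: rmorph1|exact: rmorphM].
exact: (can2_monoid_morphism (aut_funK s) (aut_invK s)).
Qed.

HB.instance Definition _ s k :=
  GRing.isZmodMorphism.Build K K (aut_pow s k) (aut_pow_zmod_morphism s k).
HB.instance Definition _ s k :=
  GRing.isMonoidMorphism.Build K K (aut_pow s k) (aut_pow_monoid_morphism s k).

Lemma aut_pow_fix (s : automorphism K) k c : s c = c -> aut_pow s k c = c.
Proof.
move=> sc; have ic : aut_inv s c = c by rewrite -{1}sc aut_funK.
by case: k => n /=; elim: n => //= n ->.
Qed.

Variables alpha1 alpha2 : automorphism K.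

HB.instance Definition _ g := GRing.RMorphism.copy (gact alpha1 alpha2 g)
  (aut_pow alpha1 g.1 \o aut_pow alpha2 g.2).
HB.instance Definition _ g := GRing.RMorphism.copy (gact_poly alpha1 alpha2 g)
  (poly_subst (malgC \o gact alpha1 alpha2 g) (fun b : Gam => indet K (g + b))).

Lemma gact_polyC g c : gact_poly alpha1 alpha2 g c%:MP = (gact alpha1 alpha2 g c)%:MP.
Proof. exact: (poly_substC (malgC \o gact alpha1 alpha2 g)). Qed.

Lemma gact_poly_indet g b : gact_poly alpha1 alpha2 g (indet K b) = indet K (g + b).
Proof. exact: (poly_subst_indet (malgC \o gact alpha1 alpha2 g)). Qed.

Variable B : sigma_poly K.
Local Notation J := (sigma_ideal alpha1 alpha2 B).

Lemma sigma_idealD p q : p \in J -> q \in J -> p + q \in J.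
Proof.
move=> /asboolP[s ->] /asboolP[t ->]; apply/asboolP.
by exists (s ++ t); rewrite big_cat.
Qed.

Lemma sigma_idealMl p q : q \in J -> p * q \in J.
Proof.
move=> /asboolP[s ->]; apply/asboolP.
exists [seq (p * u.1, u.2) | u <- s]; rewrite big_map mulr_sumr.
by apply: eq_bigr => u _; rewrite mulrA.
Qed.

Lemma sigma_ideal0 : 0 \in J.
Proof. by apply/asboolP; exists [::]; rewrite big_nil. Qed.

Lemma sigma_ideal_gen g : gact_poly alpha1 alpha2 g B \in J.
Proof. by apply/asboolP; exists [:: (1, g)]; rewrite big_seq1 mul1r. Qed.

Lemma sigma_ideal_ker (S : nzRingType) (f : {rmorphism sigma_poly K -> S}) p :
  (forall g, f (gact_poly alpha1 alpha2 g B) = 0) -> p \in J -> f p = 0.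
Proof.
move=> fB /asboolP[s ->]; rewrite rmorph_sum big1 // => u _.
by rewrite rmorphM fB mulr0.
Qed.

End Automorphisms.

(** * The difference scheme in a vector space *)

Section Scheme.
Variables (K : fieldType) (a : K).

(** The family [v] is arbitrary so that the same recursion serves for the indeterminates, their
    normal forms and the differences of both. *)
Definition scheme (V : lmodType K) (v : Gam -> V) (k l : int) : V :=
  a *: v (k + 1, l) + a *: v (k - 1, l) - v (k, l + 1) + v (k, l - 1)
  - (2%:R * a) *: v (k, l).

Lemma scheme_solution (V : lmodType K) (u0 u1 : int -> V) :
  exists v : Gam -> V, [/\ forall k, v (k, 0) = u0 k, forall k, v (k, 1) = u1 k
                         & forall k l, scheme v k l = 0].
Proof.
pose lap (u : int -> V) k := a *: u (k + 1) + a *: u (k - 1) - (2%:R * a) *: u k.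
pose up (s : (int -> V) * (int -> V)) := (s.2, fun k => lap s.2 k + s.1 k).
pose down (s : (int -> V) * (int -> V)) := (fun k => s.2 k - lap s.1 k, s.1).
have downK s : up (down s) = s.
  by case: s => s0 s1; congr pair; apply/funext => k /=; rewrite addrC subrK.
(* [st l] is the pair of rows [l] and [l + 1]; the recursion has order two in the second direction,
   so [up] and [down] act on such pairs. *)
pose st (l : int) := match l with
  | Posz n => iter n up (u0, u1) | Negz n => iter n.+1 down (u0, u1) end.
have stS l : st (l + 1) = up (st l).
  case: l => n; first by rewrite -PoszD addn1.
  rewrite [st (Negz n)]/= downK; have -> : Negz n + 1 = - (n%:Z) by lia.
  by case: n.
have stE l k : (st (l + 1)).1 k = lap (st l).1 k + (st (l - 1)).1 k.
  have {1 2}-> : l = l - 1 + 1 by rewrite subrK.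
  by rewrite !stS.
exists (fun g => (st g.2).1 g.1); split=> // k l.
by rewrite /scheme /= stE /lap [- (_ - _ + _)]opprD addrA subKr subrK subrr.
Qed.

(** Induction on the distance [|l|] to row 0: the scheme is solved for its extreme point in the
    second direction, and the other points are closer to row 0 or lie in row 1, still within the
    ball. *)
Lemma two_rows_closure (V : lmodType K) (v : Gam -> V) (Q : V -> Prop) (r : nat) :
    (forall x y, Q x -> Q y -> Q (x + y)) ->
    (forall c x, Q x -> Q (c *: x)) ->
    (forall k l, Q (scheme v k l)) ->
    (forall g, (gord g <= r)%N -> g.2 = 0 \/ g.2 = 1 -> Q (v g)) ->
  forall g, (gord g <= r)%N -> Q (v g).
Proof.
move=> QD QZ Qs Qv.
have QN x : Q x -> Q (- x) by rewrite -scaleN1r; apply: QZ.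
have QB x y : Q x -> Q y -> Q (x - y) by move=> Qx /QN; apply: QD.
pose w k l := a *: v (k + 1, l) + a *: v (k - 1, l) - (2%:R * a) *: v (k, l).
have schemeE k l : scheme v k l = w k l + v (k, l - 1) - v (k, l + 1).
  rewrite /scheme /w; set x := a *: v (k + 1, l) + _; set z := _ *: v (k, l).
  by rewrite [x - _ + _]addrAC [LHS]addrAC [x + _ - z]addrAC.
have upE k l : v (k, l + 1) = w k l + v (k, l - 1) - scheme v k l.
  by rewrite schemeE subKr.
have downE k l : v (k, l - 1) = scheme v k l - w k l + v (k, l + 1).
  by rewrite schemeE addrAC subrK addrC addKr.
suff Qn n l : (`|l| <= n)%N -> forall k, (gord (k, l) <= r)%N -> Q (v (k, l)).
  by case=> k l; apply: Qn.
elim: n l => [|n IHn] l ln k kr; first by apply: Qv => //=; left; lia.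
rewrite /gord /= in IHn kr.
have [l01|l01] := boolP ((l == 0) || (l == 1)).
  by apply: Qv => //=; case/orP: l01 => /eqP; [left|right].
(* The strict bound leaves room for the neighbours [k + 1] and [k - 1]. *)
have Qw l' : (`|l'| <= n)%N -> (`|k| + `|l'| < r)%N -> Q (w k l').
  by move=> ln' kr'; apply: QB; [apply: QD|]; apply: QZ; apply: IHn => //; lia.
have [l_gt1|l_lt0] : (1 < l) \/ (l < 0) by lia.
  rewrite -[l](subrK 1) upE; apply: QB => //; apply: QD; [apply: Qw|apply: IHn]; lia.
rewrite -[l](addrK 1) downE; apply: QD; first by apply: QB => //; apply: Qw; lia.
(* For [l = -1] the point two rows above is [(k, 1)], no closer to row 0 but of the same order as
   [(k, -1)]; it is covered by the hypothesis on row 1. *)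
have [->|l_neq] := eqVneq (l + 1 + 1) 1; last by apply: IHn; lia.
by apply: Qv => /=; [rewrite /gord /=; lia|right].
Qed.

(** Compatibility is asked for the scalar [a] alone because [gact_poly] twists the other scalars;
    the factor 2 is absorbed by additivity. *)
Lemma scheme_raddf (V W : lmodType K) (f : {additive V -> W}) (v : Gam -> V) k l :
  (forall x, f (a *: x) = a *: f x) -> f (scheme v k l) = scheme (f \o v) k l.
Proof.
move=> fZ; rewrite /scheme mulr_natl mulr2n !scalerDl.
by rewrite 3!(raddfB, raddfD) !raddfD /= !fZ.
Qed.

Lemma scheme_shift (V : lmodType K) (v : Gam -> V) g k l :
  scheme (fun b => v (g + b)) k l = scheme v (g.1 + k) (g.2 + l).
Proof. by case: g => g1 g2; rewrite /scheme /= -!addrA. Qed.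

Lemma schemeB (V : lmodType K) (u v : Gam -> V) k l :
  scheme (fun g => u g - v g) k l = scheme u k l - scheme v k l.
Proof.
have BD (x x' y y' : V) : (x - x') + (y - y') = (x + y) - (x' + y').
  by rewrite opprD addrACA.
by rewrite /scheme !scalerBr !(opprD (u _)) !(opprD (_ *: u _)) !BD.
Qed.

End Scheme.

(** * Kernels of morphisms into polynomial rings are prime *)

Section KernelIdeal.
Variables (R : comNzRingType) (K : idomainType) (I : choiceType).
Variable f : {rmorphism R -> {malg K[{cmonom I}]}}.

Definition rker : pred R := fun p => f p == 0.

Lemma rker_idealr_closed : idealr_closed rker.
Proof.
split=> [||x u v]; rewrite ?unfold_in /rker ?rmorph0 ?rmorph1 ?oner_eq0 //.
by move=> /eqP fu /eqP fv; rewrite rmorphD rmorphM fu fv mulr0 addr0.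
Qed.

Lemma rker_prime_idealr_closed : prime_idealr_closed rker.
Proof. by move=> u v; rewrite !unfold_in /rker rmorphM malg_cmonom_mulf_eq0. Qed.

HB.instance Definition _ := isIdealr.Build R rker rker_idealr_closed.
HB.instance Definition _ := isPrimeIdealrClosed.Build R rker rker_prime_idealr_closed.

End KernelIdeal.

(** * Primality of the ideal and its dimension polynomial *)

Section StrengthOfScheme.
Variables (K : fieldType) (alpha1 alpha2 : automorphism K) (a : K).
Hypotheses (a1 : alpha1 a = a) (a2 : alpha2 a = a).
Local Notation diff := (scheme a (fun g : Gam => indet K g)).
Local Notation J := (sigma_ideal alpha1 alpha2 (diff 0 0)).

(** Since [a] is constant, the action moves the base point and leaves the coefficients unchanged. *)
Lemma gact_poly_scheme g k l :
  gact_poly alpha1 alpha2 g (diff k l) = diff (g.1 + k) (g.2 + l).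
Proof.
rewrite -scheme_shift scheme_raddf => [|p].
  by congr (scheme a _ k l); apply/funext => b /=; rewrite gact_poly_indet.
by rewrite /= -!mul_malgC rmorphM /= gact_polyC /gact !aut_pow_fix.
Qed.

Lemma scheme_sigma_ideal k l : diff k l \in J.
Proof.
have := sigma_ideal_gen alpha1 alpha2 (diff 0 0) (k, l).
by rewrite gact_poly_scheme !addr0.
Qed.

Lemma sigma_ideal_stable : sigma_stable alpha1 alpha2 J.
Proof.
move=> g p /asboolP[s ->]; rewrite rmorph_sum.
elim/big_ind: _ => [|p1 p2|[q h] _]; [exact: sigma_ideal0|exact: sigma_idealD|].
rewrite rmorphM /= !gact_poly_scheme !addr0.
exact/sigma_idealMl/scheme_sigma_ideal.
Qed.

Variable v : Gam -> sigma_poly K.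
Hypotheses (v0 : forall k, v (k, 0) = indet K (k, 0))
  (v1 : forall k, v (k, 1) = indet K (k, 1)) (v_sol : forall k l, scheme a v k l = 0).

Definition normal_form : sigma_poly K -> sigma_poly K := poly_subst malgC v.
HB.instance Definition _ := GRing.RMorphism.copy normal_form
  (poly_subst (malgC : {rmorphism K -> sigma_poly K}) v).

Lemma normal_formC c : normal_form c%:MP = c%:MP.
Proof. exact: (poly_substC (malgC : {rmorphism K -> sigma_poly K})). Qed.

Lemma normal_form_indet g : normal_form (indet K g) = v g.
Proof. exact: (poly_subst_indet (malgC : {rmorphism K -> sigma_poly K})). Qed.

Lemma normal_form_scheme k l : normal_form (diff k l) = 0.
Proof.
rewrite scheme_raddf => [|p].
  rewrite -[RHS](v_sol k l); congr (scheme a _ k l).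
  by apply/funext => g; apply: normal_form_indet.
by rewrite /= -!mul_malgC rmorphM /= normal_formC.
Qed.

Lemma sub_normal_form_sigma_ideal p : p - normal_form p \in J.
Proof.
elim/malg_indet_ind: p => [c|g|p q pJ qJ|p q pJ qJ].
- by rewrite normal_formC subrr sigma_ideal0.
(* This family vanishes on rows 0 and 1, and its scheme equals [diff], because [v] solves the
   scheme. *)
- apply: (@two_rows_closure _ a _ (fun g => indet K g - normal_form (indet K g))
    (fun p => p \in J) (gord g)) => // [p q|c p|k l|[k l] /= _ l01].
  + exact: sigma_idealD.
  + by rewrite -mul_malgC; apply: sigma_idealMl.
  + suff -> : scheme a (fun g => indet K g - normal_form (indet K g)) k l = diff k l.
      exact: scheme_sigma_ideal.
    rewrite schemeB -[RHS]subr0 -(v_sol k l); congr (_ - scheme a _ k l).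
    by apply/funext => h; rewrite normal_form_indet.
  + rewrite normal_form_indet.
    by case: l01 => ->; rewrite ?v0 ?v1 subrr sigma_ideal0.
- rewrite [normal_form (p + q)]rmorphD opprD addrACA /=.
  exact: (sigma_idealD pJ qJ).
rewrite [normal_form (p * q)]rmorphM /=.
have -> : p * q - normal_form p * normal_form q =
    q * (p - normal_form p) + normal_form p * (q - normal_form q).
  by rewrite !mulrBr [normal_form p * q]mulrC addrA subrK [q * p]mulrC.
exact: (sigma_idealD (sigma_idealMl q pJ) (sigma_idealMl (normal_form p) qJ)).
Qed.

Local Notation P := (rker normal_form).

(** An element killed by [normal_form] equals [p - normal_form p], which is in the ideal; conversely
    [normal_form] kills every generator. *)
Lemma rker_normal_form : P =i J.
Proof.
move=> p; apply/idP/idP => [/eqP p0|pJ].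
  by rewrite -[p]subr0 -p0 sub_normal_form_sigma_ideal.
rewrite unfold_in /rker; apply/eqP; apply: sigma_ideal_ker pJ => g /=.
by rewrite gact_poly_scheme normal_form_scheme.
Qed.

Local Notation res := (to_residue_field (rker normal_form)).

Lemma residue_two_rows_closure (r : nat) (F : divringClosed (residue_field P)) :
    (forall c, res c%:MP \in F) ->
    (forall g, (gord g <= r)%N -> g.2 = 0 \/ g.2 = 1 -> res (indet K g) \in F) ->
  forall g, (gord g <= r)%N -> res (indet K g) \in F.
Proof.
move=> FK F01; apply: (@two_rows_closure _ a _ _ (fun p => res p \in F)) => //.
- by move=> p q Fp Fq; rewrite rmorphD rpredD.
- by move=> c p Fp; rewrite -mul_malgC rmorphM; apply: rpredM (FK c) Fp.
move=> k l; suff /eqP -> : res (diff k l) == 0 by rewrite rpred0.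
by rewrite to_residue_field_eq0 unfold_in /rker /= normal_form_scheme.
Qed.

(** A relation lifts to a polynomial in the indeterminates of rows 0 and 1 lying in the kernel of
    [normal_form]; these indeterminates are fixed by [normal_form], so that polynomial is 0. *)
Lemma two_rows_alg_independent (I : finType) (b : I -> Gam) :
    injective b -> (forall i, (b i).2 = 0 \/ (b i).2 = 1) ->
  alg_independent (fun c : K => res c%:MP) (fun i => res (indet K (b i))).
Proof.
move=> b_inj b01 p.
pose C (J : choiceType) : {rmorphism K -> {malg K[{cmonom J}]}} := malgC.
pose sub := poly_subst (C Gam) (fun i => indet K (b i)).
have -> : poly_subst (fun c : K => res c%:MP) (fun i => res (indet K (b i))) p
    = res (sub p).
  apply: (rmorph_indet_ext
    (f := poly_subst (res \o C Gam) (fun i => res (indet K (b i))))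
    (g := res \o sub)) => [c|i] /=.
    by rewrite (poly_substC (res \o C Gam)) (poly_substC (C Gam)).
  by rewrite (poly_subst_indet (res \o C Gam)) (poly_subst_indet (C Gam)).
move/eqP; rewrite to_residue_field_eq0 unfold_in /rker /= => /eqP.
have -> : normal_form (sub p) = sub p.
  apply: (rmorph_indet_ext (f := normal_form \o sub) (g := sub)) => [c|i] /=.
    by rewrite (poly_substC (C Gam)) normal_formC.
  rewrite (poly_subst_indet (C Gam)) normal_form_indet.
  by case: (b i) (b01 i) => k l /= [] ->.
(* A left inverse of the renaming [sub], available since [b] is injective; indeterminates outside
   the image of [b] go to the default value 0. *)
pose back g := if [pick i | b i == g] is Some i then indet K i else 0.
move/(congr1 (poly_subst (C I) back)); rewrite rmorph0 => <-; symmetry.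
apply: (rmorph_indet_ext (f := poly_subst (C I) back \o sub) (g := idfun))
  => [c|i] /=.
  by rewrite !poly_substC.
rewrite !poly_subst_indet /back; case: pickP => [j /eqP/b_inj -> //|/(_ i)].
by rewrite eqxx.
Qed.

Lemma adjoin_algebraic (L : fieldType) (iota : K -> L) (X : L -> Prop) z :
  adjoin iota X z -> algebraic_over (adjoin iota X) z.
Proof.
move=> Xz; exists ('X - z%:P); split; [by rewrite polyXsubC_eq0| |by rewrite root_XsubC].
move=> i F FK FX; have Fz := Xz F FK FX.
by rewrite coefB coefX coefC rpredB ?rpred_nat //; case: ifP => // _; apply: rpred0.
Qed.

(** At [r = 0] the ball is one point, of row 0, and the degree is 1 instead of [4 * r]. *)
Lemma two_rows_trdeg (r : nat) : (0 < r)%N ->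
  trdeg_eq (fun c : K => res c%:MP)
    (adjoin (fun c : K => res c%:MP)
       (fun z => exists2 g : Gam, (gord g <= r)%N & z = res (indet K g)))
    (4 * r).
Proof.
move=> r_gt0.
(* The ball of radius [r] meets row 0 in the points [|k| <= r] and row 1 in the
   points [|k| < r], that is [2 * r + 1] and [2 * r - 1] of them. *)
pose b (i : 'I_(4 * r)) : Gam :=
  if (i <= 2 * r)%N then (i%:Z - r%:Z, 0) else (i%:Z - (3 * r)%:Z, 1).
have b_row i : (b i).2 = 0 \/ (b i).2 = 1 by rewrite /b; case: ifP; [left|right].
have b_ord i : (gord (b i) <= r)%N.
  by have := ltn_ord i; rewrite /b /gord; case: (leqP i (2 * r)) => /=; lia.
have b_inj : injective b.
  move=> i j; rewrite /b => bij; apply: val_inj => /=.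
  by move: bij; case: (leqP i _) => _; case: (leqP j _) => _ // []; lia.
have b_surj g : (gord g <= r)%N -> g.2 = 0 \/ g.2 = 1 -> exists i, g = b i.
  case: g => k l; rewrite /gord /= => kl_r [l0|l1]; subst l.
    (* The indices invert [b] on each row; [k + r] here and [k + 3 * r] below are nonnegative, so
       [absz] only converts them to naturals. *)
    have lt_i : (absz (k + r%:Z)%R < 4 * r)%N by lia.
    exists (Ordinal lt_i); rewrite /b /= ifT; [congr pair|]; lia.
  have lt_i : (absz (k + (3 * r)%:Z)%R < 4 * r)%N by lia.
  exists (Ordinal lt_i); rewrite /b /= ifF; [congr pair|]; lia.
exists (fun i => res (indet K (b i))); split.
- by move=> i F FK FX; apply: FX; exists (b i).
- exact: two_rows_alg_independent.
(* The generators of the ball already lie in the field generated by the basis, so [z] does too and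
   is a root of a linear polynomial over it. *)
move=> z Fz; apply: adjoin_algebraic => F FK FX; apply: Fz => // _ [g g_r ->].
apply: (residue_two_rows_closure FK) g_r => h h_r /(b_surj h h_r)[i ->].
by apply: FX; exists i.
Qed.

End StrengthOfScheme.

Theorem mainTheorem5 (K : fieldType) (charK : [pchar K] =i pred0)
    (alpha1 alpha2 : automorphism K)
    (alphaC : forall f : K, alpha1 (alpha2 f) = alpha2 (alpha1 f))
    (a : K) (a_neq0 : a != 0) (a_const : alpha1 a = a /\ alpha2 a = a) :
  let B : sigma_poly K := a *: gy K 1 0 + a *: gy K (-1) 0 - gy K 0 1 + gy K 0 (-1)
                   - (2%:R * a) *: gy K 0 0 in
  exists P : prime_idealr (sigma_poly K),
    [/\ P =i sigma_ideal alpha1 alpha2 B,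
        sigma_stable alpha1 alpha2 P
      & sigma_dim_poly P (4%:R *: 'X)].
Proof.
case: a_const => a1 a2 B.
have [v [v0 v1 v_sol]] := scheme_solution a (fun k => indet K (k, 0 : int))
  (fun k => indet K (k, 1 : int)).
have PJ := rker_normal_form a1 a2 v0 v1 v_sol.
exists (rker (normal_form v)).
split; first exact: PJ.
  move=> g p; rewrite !PJ; exact: sigma_ideal_stable.
exists 1%N => r r_gt0; exists (4 * r)%N; first exact: (two_rows_trdeg v0 v1 v_sol).
by rewrite hornerZ hornerX natrM.
Qed.
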